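(* Let $q\ge 1$ be an integer, let $G$ be a simple connected graph with $n\ge 2$ nodes and $m$ edges, and let $S_q(G)$ be its $q$-subdivision graph. Then $$K(S_q(G))=4K(G)+\frac{2mq-2n+1}{2}.$$
   Context: The $q$-subdivision graph $S_q(G)$ is obtained from $G$ by replacing each edge $uv$ with $q$ disjoint paths of length $2$: $ux_1v,\ldots,ux_qv$. For a connected graph $G$ with $n$ nodes, $m$ edges and degrees $d_j$, Kemeny's constant is $K(G)=\sum_{j=1}^n\pi_jT_{ij}$, where $\pi_j=d_j/(2m)$ is the stationary distribution of the unbiased random walk on $G$ (at each step, jump to a uniformly random neighbor) and $T_{ij}$ is the expected number of steps to first reach $j$ from $i$, with $T_{ii}=0$. This value is independent of the starting node $i$. *)

(* Defs.v *)
From mathcomp Require Import all_boot all_order all_algebra.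

Set Implicit Arguments.
Unset Strict Implicit.
Unset Printing Implicit Defensive.

Import Order.TTheory GRing.Theory Num.Theory.

Local Open Scope ring_scope.

(* A simple graph is a symmetric irreflexive [e : rel T] on a finType [T]. *)

Definition connected_graph (T : finType) (e : rel T) : Prop :=
  forall x y : T, connect e x y.

Definition edge_set (T : finType) (e : rel T) : {set {set T}} :=
  [set [set x; y] | x in T, y in T & e x y].

Definition degree (T : finType) (e : rel T) (x : T) : nat :=
  #|[set y | e x y]|.

(* The new node [inr (uv, k)] is the midpoint of the [k]-th of the [q] paths
   of length 2 that replace the edge [uv]. *)
Definition subdiv_node (T : finType) (e : rel T) (q : nat) : finType :=
  (T + {uv : {set T} | uv \in edge_set e} * 'I_q)%type.

Definition subdiv (T : finType) (e : rel T) (q : nat) :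
    rel (subdiv_node e q) :=
  fun a b =>
    match a, b with
    | inl u, inr (uv, _) => u \in val uv
    | inr (uv, _), inl u => u \in val uv
    | _, _ => false
    end.

(* Loaded only here because its notations for classical sets would capture the
   finite-set comprehensions above. *)
From mathcomp Require Import all_classical all_reals all_analysis.

Local Open Scope ring_scope.

Definition step_prob (R : realType) (T : finType) (e : rel T) (x y : T) : R :=
  if e x y then (degree e x)%:R^-1 else 0.

(* Probability that the random walk started at [x] has [p] as its next
   [size p] positions. *)
Fixpoint walk_prob (R : realType) (T : finType) (e : rel T) (x : T)
    (p : seq T) : R :=
  if p is y :: p' then step_prob R e x y * walk_prob R e y p' else 1.

(* Probability that the random walk [X] with [X_0 = i] visits [j] for the first
   time at time [t]: in the trajectory [i :: p], [belast i p] lists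
   [X_0, ..., X_(t-1)] and [last i p] is [X_t]. *)
Definition first_visit_prob (R : realType) (T : finType) (e : rel T)
    (i j : T) (t : nat) : R :=
  \sum_(p : t.-tuple T | (last i p == j) && (j \notin belast i p))
    walk_prob R e i p.

Local Open Scope ereal_scope.

(* Expectation of the first time [j] is visited, a random variable with values
   in the naturals or [+oo]; the second term accounts for the event that [j] is
   never visited (recall that [+oo * 0 = 0]). *)
Definition hitting_time (R : realType) (T : finType) (e : rel T) (i j : T) :
    \bar R :=
  \sum_(0 <= t <oo) (t%:R * first_visit_prob R e i j t)%:E
  + +oo * (1 - \sum_(0 <= t <oo) (first_visit_prob R e i j t)%:E).

Definition stationary (R : realType) (T : finType) (e : rel T) (j : T) : R :=
  ((degree e j)%:R / (2 * #|edge_set e|%:R))%R.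

Definition kemeny (R : realType) (T : finType) (e : rel T) (i : T) : \bar R :=
  \sum_(j : T) (stationary R e j)%:E * hitting_time R e i j.

(* Main.v *)
Require Import Defs.
From mathcomp Require Import all_boot all_order all_algebra.
From mathcomp Require Import all_classical all_reals all_analysis.
From mathcomp Require Import ring lra.

Set Implicit Arguments.
Unset Strict Implicit.
Unset Printing Implicit Defensive.

Import Order.TTheory GRing.Theory Num.Theory.
Import numFieldNormedType.Exports.

Local Open Scope ring_scope.

(** Let [P] be the transition operator of the random walk and [pi] its stationary
    distribution. Call [g] a deviation kernel when [(I - P) g = I - 1 pi] and
    every row of [g] sums to 0 (the group inverse of [I - P] is one). For such a
    [g] the function [h x = (g z z - g x z) / pi z] vanishes at [z] and satisfies
    [h = 1 + P h] elsewhere, which forces it to be the expected hitting time of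
    [z]; summing [pi z * h x] over [z], the row sum drops out and Kemeny's constant
    is the trace of [g], whatever the starting node ([kemeny_trace]). The theorem
    therefore reduces to the comparison of two traces.

    A kernel [g] exists for every connected graph ([deviation_kernel_exists]):
    [I - P + 1 pi] is injective, because a harmonic function on a connected graph
    is constant.

    For the subdivision, two steps from an old node amount to one step of the lazy
    walk on the original graph, so [(I - P_S) G = I - 1 pi_S] restricted to the old
    rows becomes [(I - P) A / 2 = ...], which [g] solves explicitly; each new row
    is then the average of the rows at the two ends of the subdivided edge, plus an
    explicit correction ([subdiv_deviation]). The trace of the resulting kernel is
    computed by turning sums over edges and their ends into sums over neighbours;
    the off-diagonal terms [P(y, z) g z y] come back to the diagonal through the
    equation of [g] ([subdiv_dev_trace]).

    That the bounded solution [h] is the expected hitting time, defined as a series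
    over trajectories, comes from the walk killed at [z]: with [Q] its operator,
    the first-visit probabilities and the survival probabilities are successive
    differences of [Q^t 1] and [Q^t h], so the series telescope, and [Q^t h] decays
    geometrically ([hitting_time_eq]). *)

(** * The transition operator *)

Section WalkMean.
Variables (R : realType) (T : finType) (e : rel T).
Implicit Types (f g : T -> R) (x y z : T).

Definition walk_mean f x : R := \sum_y step_prob R e x y * f y.

Lemma walk_meanE f x :
  walk_mean f x = (\sum_(y | e x y) f y) / (degree e x)%:R.
Proof.
rewrite /walk_mean mulr_suml [RHS]big_mkcond /=; apply: eq_bigr => y _.
by rewrite /step_prob; case: (e x y); rewrite ?mul0r // mulrC.
Qed.

Lemma walk_meanB f g x :
  walk_mean (fun y => f y - g y) x = walk_mean f x - walk_mean g x.
Proof. by rewrite /walk_mean -sumrB; apply: eq_bigr => y _; rewrite mulrBr. Qed.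

Lemma walk_meanZ c f x : walk_mean (fun y => c * f y) x = c * walk_mean f x.
Proof. by rewrite /walk_mean mulr_sumr; apply: eq_bigr => y _; rewrite mulrCA. Qed.

Lemma ler_walk_mean f g x :
  (forall y, f y <= g y) -> walk_mean f x <= walk_mean g x.
Proof.
move=> fg; apply: ler_sum => y _; apply: ler_wpM2l => //.
by rewrite /step_prob; case: ifP => // _; rewrite invr_ge0.
Qed.

Lemma walk_mean_cst c x : (0 < degree e x)%N -> walk_mean (fun=> c) x = c.
Proof.
move=> dx; rewrite walk_meanE sumr_const.
have -> : #|e x| = degree e x by rewrite /degree cardsE.
by rewrite -[c *+ _]mulr_natr mulfK // pnatr_eq0 -lt0n.
Qed.

End WalkMean.

(** * First-visit probabilities and geometric decay *)

Lemma first_visit_prob0 (R : realType) (T : finType) (e : rel T) (x z : T) :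
  first_visit_prob R e x z 0 = (x == z)%:R.
Proof.
rewrite /first_visit_prob big_mkcond (big_pred1 [tuple]) /=.
  by case: eqVneq.
by move=> p; apply/esym/eqP; apply: tuple0.
Qed.

(** Conditioning on the first step, in the form of the bijection between
    trajectories of length [t.+1] and pairs of a next position and a trajectory of
    length [t]. *)
Lemma first_visit_probS (R : realType) (T : finType) (e : rel T) (x z : T) t :
  first_visit_prob R e x z t.+1 =
  if x == z then 0 else walk_mean e (fun y => first_visit_prob R e y z t) x.
Proof.
rewrite /first_visit_prob.
rewrite (reindex (fun yp : T * t.-tuple T => cons_tuple yp.1 yp.2)) /=; last first.
  exists (fun p : t.+1.-tuple T => (thead p, behead_tuple p)) => [[y p] _|p _].
    by congr (_, _); apply: val_inj.
  by rewrite [RHS]tuple_eta; apply: val_inj.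
have [->|xz] := eqVneq x z.
  by rewrite big_pred0 // => yp; rewrite in_cons eqxx andbF.
rewrite /walk_mean; under [RHS]eq_bigr do rewrite mulr_sumr.
rewrite pair_big_dep /=; apply: eq_big => [[y p]|[y p] _] //=.
by rewrite in_cons negb_or [z == x]eq_sym xz.
Qed.

(** [n * s ^ n] is at most [1 + s + ... + s ^ n.-1], each of whose terms is at least
    [s ^ n]. *)
Lemma natr_exprM_ub (R : realType) (s : R) n :
  0 <= s < 1 -> n%:R * s ^+ n <= (1 - s)^-1.
Proof.
case/andP=> s0 s1; rewrite -[leRHS]mul1r ler_pdivlMr ?subr_gt0 //.
have -> : n%:R * s ^+ n * (1 - s) = (1 - s) * \sum_(i < n) s ^+ n.
  by rewrite sumr_const card_ord -[s ^+ n *+ n]mulr_natl mulrC.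
apply: (@le_trans _ _ ((1 - s) * \sum_(i < n) s ^+ i)).
  rewrite ler_wpM2l ?subr_ge0 ?(ltW s1) //; apply: ler_sum => i _.
  by apply: ler_wiXn2l; rewrite ?(ltW s1) // ltnW.
by rewrite -opprB mulNr -subrX1 opprB gerBl exprn_ge0.
Qed.

Lemma cvg_natr_expr (R : realType) (r : R) :
  0 <= r < 1 -> ((fun n => n%:R * r ^+ n : R) @ \oo --> (0 : R))%classic.
Proof.
case/andP=> r0 r1.
(* By the arithmetic-geometric inequality [r <= s ^ 2], so one factor [s ^ n]
   absorbs [n] and the other tends to 0. *)
pose s : R := (1 + r) / 2.
have s0 : 0 <= s by rewrite /s; lra.
have s1 : s < 1 by rewrite /s; lra.
have rs2 : r <= s ^+ 2 by rewrite /s; nra.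
apply: (@squeeze_cvgr _ _ _ _ (fun=> 0) (geometric (1 - s)^-1 s)).
- apply: nearW => n; rewrite mulr_ge0 ?exprn_ge0 //=.
  apply: (@le_trans _ _ (n%:R * s ^+ n * s ^+ n)); last first.
    by rewrite ler_wpM2r ?exprn_ge0 // natr_exprM_ub ?s0.
  rewrite -mulrA -exprD addnn -mul2n exprM ler_wpM2l //.
  by rewrite lerXn2r // nnegrE exprn_ge0.
- exact: cvg_cst.
- by apply: cvg_geometric; rewrite ger0_norm.
Qed.

(** * The walk killed at its target *)

Section Killed.
Variables (R : realType) (T : finType) (e : rel T) (z : T).
Implicit Types (f g h : T -> R) (x y : T).

Definition killed f : T -> R :=
  fun x => if x == z then 0 else walk_mean e f x.

Lemma iter_killedB t f g :
  iter t killed (fun y => f y - g y) =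
  (fun y => iter t killed f y - iter t killed g y).
Proof.
elim: t => //= t ->; apply: funext => x; rewrite /killed.
by case: ifP; rewrite ?subr0 // walk_meanB.
Qed.

Lemma ler_killed f g :
  (forall y, f y <= g y) -> forall y, killed f y <= killed g y.
Proof. by move=> fg y; rewrite /killed; case: ifP => // _; apply: ler_walk_mean. Qed.

Lemma killedZ c f : killed (fun y => c * f y) = (fun y => c * killed f y).
Proof.
by apply: funext => y; rewrite /killed; case: ifP; rewrite ?mulr0 ?walk_meanZ.
Qed.

Lemma first_visit_prob_iter x t :
  first_visit_prob R e x z t = iter t killed (fun y => (y == z)%:R) x.
Proof.
elim: t x => [|t IHt] x; first exact: first_visit_prob0.
rewrite first_visit_probS /= /killed.
by under [X in walk_mean _ X]eq_fun do rewrite IHt.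
Qed.

End Killed.

(** * Expected hitting times solve a linear system *)

Section HittingTime.
Variables (R : realType) (T : finType) (e : rel T) (z : T) (h : T -> R).
Hypothesis deg_gt0 : forall x, (0 < degree e x)%N.
Hypothesis h_target : h z = 0.
Hypothesis h_step : forall x, x != z -> h x = 1 + walk_mean e h x.

Local Notation Q := (@killed R T e z).
(* [alive t.+1 x] is the probability that the walk from [x] has not visited [z] up
   to time [t], and [rest t x] is the expectation of the excess of the hitting
   time over [t]. *)
Local Notation alive t x := (iter t Q (fun=> 1) x).
Local Notation rest t x := (iter t Q h x).

(** A minimum of [h] is attained at [z]: elsewhere [h] exceeds its mean over the
    neighbours by 1. *)
Lemma expected_time_ge0 x : 0 <= h x.
Proof.
have [y _ ymin] := @Order.TotalTheory.arg_minP _ _ T z xpredT h isT.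
suff yz : y = z by rewrite -h_target -yz; apply: ymin.
apply/eqP; apply: contraT => /h_step hy.
have : walk_mean e (fun=> h y) y <= walk_mean e h y.
  by apply: ler_walk_mean => w; apply: ymin.
by rewrite walk_mean_cst // => hle; lra.
Qed.

Lemma killed1 x : Q (fun=> 1) x = (x != z)%:R.
Proof. by rewrite /killed; case: eqVneq => //= _; rewrite walk_mean_cst. Qed.

Lemma killed_expected_time x : Q h x = h x - (x != z)%:R.
Proof.
rewrite /killed; case: eqVneq => [->|/h_step ->] /=.
  by rewrite h_target subr0.
by rewrite addrC addKr.
Qed.

Lemma first_visit_prob_alive x t :
  first_visit_prob R e x z t = alive t x - alive t.+1 x.
Proof.
rewrite first_visit_prob_iter iterSr.
have -> : (fun y => (y == z)%:R) = (fun y => 1 - Q (fun=> 1) y) :> (T -> R).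
  by apply: funext => y; rewrite killed1; case: eqP; rewrite ?subrr ?subr0.
by rewrite iter_killedB.
Qed.

Lemma alive_rest x t : alive t.+1 x = rest t x - rest t.+1 x.
Proof.
rewrite !iterSr.
have -> : Q (fun=> 1) = (fun y => h y - Q h y).
  by apply: funext => y; rewrite killed1 killed_expected_time subKr.
by rewrite iter_killedB.
Qed.

Lemma iter_killed_ge0 f x t : (forall y, 0 <= f y) -> 0 <= iter t Q f x.
Proof.
move=> f0; elim: t x => // t IHt x /=; rewrite /killed; case: ifP => // _.
by rewrite -[leLHS](@walk_mean_cst R T e 0 x) //; apply: ler_walk_mean.
Qed.

Lemma alive_le_rest x t : alive t.+1 x <= rest t x.
Proof.
rewrite alive_rest gerBl.
by apply: iter_killed_ge0 => y; apply: expected_time_ge0.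
Qed.

(** As [h] is bounded by some [C], the identity [Q h = h - 1] off [z] gives
    [Q h <= (1 - 1 / C) h], which can be iterated because [Q] is monotone. *)
Lemma rest_geometric :
  exists2 r : R, 0 <= r < 1 & forall x t, rest t x <= r ^+ t * h x.
Proof.
(* The summand 1 makes [C >= 1], so that the ratio is nonnegative. *)
pose C : R := 1 + \sum_y h y.
have hC x : h x <= C.
  rewrite /C (bigD1 x) //= -[leLHS]addr0 addrCA lerD2l.
  by rewrite addr_ge0 // sumr_ge0 // => y _; apply: expected_time_ge0.
have C1 : 1 <= C by rewrite lerDl sumr_ge0 // => y _; apply: expected_time_ge0.
have C0 : 0 < C by apply: lt_le_trans C1.
have CV1 : C^-1 <= 1 by rewrite invf_le1.
have CV0 : 0 < C^-1 by rewrite invr_gt0.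
set r : R := 1 - C^-1; have r0 : 0 <= r by rewrite /r; lra.
exists r; first by rewrite r0 /r; lra.
move=> x t; elim: t x => [|t IHt] x; first by rewrite expr0 mul1r.
rewrite iterS.
apply: (le_trans (@ler_killed R T e z _ (fun y => r ^+ t * h y) IHt x)).
rewrite killedZ exprSr -mulrA.
rewrite ler_wpM2l ?exprn_ge0 // /r.
rewrite killed_expected_time mulrBl mul1r lerD2l lerN2.
case: eqVneq => [->|_] /=; first by rewrite h_target mulr0.
by rewrite mulrC ler_pdivrMr // mul1r.
Qed.

Lemma cvg_alive x : ((fun n => alive n x) @ \oo --> (0 : R))%classic.
Proof.
have [r r01 restr] := rest_geometric; have /andP[r0 r1] := r01.
rewrite -cvg_shiftS.
apply: (@squeeze_cvgr _ _ _ _ (fun=> 0) (geometric (h x) r)).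
- apply: nearW => n; apply/andP; split; first exact: iter_killed_ge0.
  apply: (le_trans (alive_le_rest x n)).
  by rewrite /geometric /= mulrC.
- exact: cvg_cst.
- by apply: cvg_geometric; rewrite ger0_norm.
Qed.

Lemma cvg_rest x : ((fun n => rest n x) @ \oo --> (0 : R))%classic.
Proof.
have [r r01 restr] := rest_geometric; have /andP[r0 r1] := r01.
apply: (@squeeze_cvgr _ _ _ _ (fun=> 0) (geometric (h x) r)).
- apply: nearW => n; apply/andP; split; last by rewrite /geometric /= mulrC.
  by apply: iter_killed_ge0 => y; apply: expected_time_ge0.
- exact: cvg_cst.
- by apply: cvg_geometric; rewrite ger0_norm.
Qed.

Lemma cvg_natr_alive x :
  ((fun n => n%:R * alive n.+1 x) @ \oo --> (0 : R))%classic.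
Proof.
have [r r01 restr] := rest_geometric; have /andP[r0 r1] := r01.
apply: (@squeeze_cvgr _ _ _ _ (fun=> 0) (fun n => n%:R * r ^+ n * h x)).
- apply: nearW => n; apply/andP; split.
    by rewrite mulr_ge0 //; apply: iter_killed_ge0.
  rewrite -mulrA ler_wpM2l //.
  exact: le_trans (alive_le_rest x n) (restr x n).
- exact: cvg_cst.
- rewrite -[X in (_ --> X)%classic](mul0r (h x)).
  by apply: cvgMr_tmp; apply: cvg_natr_expr.
Qed.

Lemma sum_first_visit x :
  (\sum_(0 <= t <oo) (first_visit_prob R e x z t)%:E)%E = 1%:E.
Proof.
apply: cvg_lim => //.
have -> : (fun n => \sum_(0 <= t < n) (first_visit_prob R e x z t)%:E)%E
          = (fun n => (1 - alive n x)%:E).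
  apply: funext => n; rewrite sumEFin; congr (_%:E).
  elim: n => [|n IHn]; first by rewrite big_geq // subrr.
  by rewrite big_nat_recr //= IHn first_visit_prob_alive addrA subrK.
apply: cvg_EFin; first exact: nearW.
rewrite -[X in (_ --> X)%classic](subr0 (1 : R)).
by apply: cvgB; [exact: cvg_cst | exact: cvg_alive].
Qed.

Lemma sum_mul_first_visit x :
  (\sum_(0 <= t <oo) (t%:R * first_visit_prob R e x z t)%:E)%E = (h x)%:E.
Proof.
apply: cvg_lim => //; rewrite -cvg_shiftS.
have -> : (fun n =>
    \sum_(0 <= t < n.+1) (t%:R * first_visit_prob R e x z t)%:E)%E
          = (fun n => (h x - rest n x - n%:R * alive n.+1 x)%:E).
  apply: funext => n; rewrite sumEFin; congr (_%:E).
  (* Summation by parts trades the weight [t] for the sum of the terms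
     [alive t.+1 = rest t - rest t.+1], which telescopes in turn. *)
  elim: n => [|n IHn]; first by rewrite big_nat1 /= subrr !mul0r subrr.
  rewrite big_nat_recr //= -!iterS IHn first_visit_prob_alive.
  by rewrite -natr1 (alive_rest x n); ring.
apply: cvg_EFin; first exact: nearW.
rewrite -[X in (_ --> X)%classic](subr0 (h x)).
rewrite -[X in (_ --> X)%classic](subr0 (h x - 0)).
apply: cvgB; last exact: cvg_natr_alive.
by apply: cvgB; [exact: cvg_cst | exact: cvg_rest].
Qed.

(** The probability of never visiting [z] is 0, so the infinite term of the
    definition of [hitting_time] contributes nothing. *)
Lemma hitting_time_eq x : hitting_time R e x z = (h x)%:E.
Proof.
by rewrite /hitting_time sum_mul_first_visit sum_first_visit subee // mule0 adde0.
Qed.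

End HittingTime.

(** * Sums over edges and their ends *)

Lemma edge_setP (T : finType) (e : rel T) (a : {set T}) :
  reflect (exists x y, e x y /\ a = [set x; y]%SET) (a \in edge_set e).
Proof.
apply: (iffP imset2P) => [[x y _]|[x [y [exy ->]]]].
  by rewrite inE /= => exy ->; exists x, y.
by exists x y => //; rewrite inE.
Qed.

Lemma degreeE (R : realType) (T : finType) (e : rel T) (x : T) :
  (degree e x)%:R = \sum_(y | e x y) 1 :> R.
Proof.
by rewrite sumr_const; congr (_%:R); rewrite /degree cardsE.
Qed.

Lemma stationary_gt0 (R : realType) (T : finType) (e : rel T) (x : T) :
  (0 < degree e x)%N -> 0 < stationary R e x.
Proof.
move=> dx; rewrite /stationary divr_gt0 ?ltr0n // mulr_gt0 ?ltr0n //.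
have /card_gt0P[y] := dx; rewrite inE => exy.
by apply/card_gt0P; exists [set x; y]%SET; apply/edge_setP; exists x, y.
Qed.

Lemma sum_delta (R : realType) (T : finType) (f : T -> R) x :
  \sum_y (x == y)%:R * f y = f x.
Proof.
under eq_bigr do rewrite mulr_natl mulrb eq_sym.
by rewrite -big_mkcond big_pred1_eq.
Qed.

Section SimpleGraph.
Variables (R : realType) (T : finType) (e : rel T).
Hypotheses (e_sym : symmetric e) (e_irr : irreflexive e).

Lemma sum_endpoints (F : T -> R) x y :
  e x y -> \sum_(u in [set x; y]%SET) F u = F x + F y.
Proof.
move=> exy; rewrite big_setU1 ?big_set1 //= inE.
by apply: contraTneq exy => ->; rewrite e_irr.
Qed.

(** The map [y |-> {x, y}] is a bijection from the neighbours of [x] onto the edges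
    at [x]. *)
Lemma sum_incident_edges (F : {set T} -> R) x :
  \sum_(a in edge_set e | x \in a) F a = \sum_(y | e x y) F [set x; y]%SET.
Proof.
have inj : {in [set y | e x y]%SET &, injective (fun y => [set x; y]%SET)}.
  move=> y z; rewrite !inE => exy exz /setP/(_ y).
  rewrite !inE eqxx orbT => /esym/orP[/eqP yx|/eqP//].
  by rewrite yx e_irr in exy.
transitivity (\sum_(y in [set y | e x y]%SET) F [set x; y]%SET); last first.
  by apply: eq_bigl => y; rewrite inE.
rewrite -(big_imset F inj); apply: eq_bigl => a.
apply/andP/imsetP => [[/edge_setP[u [v [euv ->]]]]|[y]].
  rewrite !inE => /orP[/eqP->|/eqP->]; first by exists v; rewrite // inE.
  by exists u; rewrite ?inE 1?e_sym // finset.setUC.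
rewrite inE => exy ->; split; last by rewrite !inE eqxx.
by apply/edge_setP; exists x, y.
Qed.

Lemma sum_edge_endpoints (F : {set T} -> T -> R) :
  \sum_(a in edge_set e) \sum_(x in a) F a x =
  \sum_x \sum_(y | e x y) F [set x; y]%SET x.
Proof.
rewrite (exchange_big_dep xpredT) //=; apply: eq_bigr => x _.
exact: (sum_incident_edges (F^~ x)).
Qed.

Lemma handshake :
  \sum_x (degree e x)%:R = 2 * #|edge_set e|%:R :> R.
Proof.
under eq_bigr do rewrite degreeE.
rewrite -(sum_edge_endpoints (fun _ _ => 1)) mulr_natr -sumr_const.
apply: eq_bigr => _ /edge_setP[x [y [exy ->]]].
by rewrite (@sum_endpoints (fun=> 1) x y).
Qed.

End SimpleGraph.

(** * Deviation kernels and Kemeny's constant *)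

Section Deviation.
Variables (R : realType) (T : finType) (e : rel T).

Definition deviation_kernel (g : T -> T -> R) : Prop :=
  (forall x z, g x z - walk_mean e (g^~ z) x = (x == z)%:R - stationary R e z) /\
  (forall x, \sum_z g x z = 0).

Hypothesis deg_gt0 : forall x, (0 < degree e x)%N.

(** The function [y |-> (g z z - g y z) / pi z] solves the system that characterizes
    the expected hitting time of [z]. The weight [pi z] cancels the denominator,
    and the sum of [g x z] over [z] vanishes. *)
Lemma kemeny_trace g x :
  deviation_kernel g -> kemeny R e x = (\sum_z g z z)%:E.
Proof.
move=> [g_eq g_row]; rewrite /kemeny.
have pi_neq0 z : stationary R e z != 0 by rewrite gt_eqF // stationary_gt0.
have hit z : hitting_time R e x z =
             ((stationary R e z)^-1 * (g z z - g x z))%:E.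
  apply: (hitting_time_eq
    (h := fun y => (stationary R e z)^-1 * (g z z - g y z))) => //.
    by rewrite subrr mulr0.
  move=> y yz; rewrite walk_meanZ (walk_meanB e (fun=> g z z) (g^~ z)).
  rewrite walk_mean_cst //.
  have := g_eq y z; rewrite (negbTE yz) sub0r => gy.
  have -> : walk_mean e (g^~ z) y = g y z + stationary R e z by lra.
  by field.
under eq_bigr => z _ do rewrite hit -EFinM mulrA divff // mul1r.
by rewrite sumEFin sumrB g_row subr0.
Qed.

Hypotheses (e_sym : symmetric e) (e_irr : irreflexive e).

Lemma edges_neq0 (x : T) : #|edge_set e|%:R != 0 :> R.
Proof.
have := stationary_gt0 R (deg_gt0 x); rewrite /stationary.
by apply: contraTneq => ->; rewrite mulr0 invr0 mulr0 ltxx.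
Qed.

Lemma sum_stationary (x : T) : \sum_z stationary R e z = 1.
Proof.
rewrite /stationary -mulr_suml handshake // divff // mulf_neq0 //.
exact: edges_neq0 x.
Qed.

Lemma stationary_walk_mean (f : T -> R) :
  \sum_x stationary R e x * walk_mean e f x = \sum_x stationary R e x * f x.
Proof.
under eq_bigr => x _.
  rewrite walk_meanE /stationary [_ * (_ / _)]mulrC mulrA mulfVK; last first.
    by rewrite pnatr_eq0 -lt0n.
  rewrite mulr_suml; over.
rewrite (exchange_big_dep xpredT) //=; apply: eq_bigr => y _.
rewrite -mulr_suml /stationary mulrAC; congr (_ / _).
rewrite degreeE mulr_suml; apply: eq_big => x; first by rewrite e_sym.
by rewrite mul1r.
Qed.

Hypothesis e_conn : connected_graph e.

(** Maximum principle: where [f] attains its maximum, it takes the same value at all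
    neighbours, so the set of maximizers is closed under adjacency. *)
Lemma harmonic_cst (f : T -> R) :
  (forall x, f x = walk_mean e f x) -> forall x y, f x = f y.
Proof.
move=> f_harm x0.
have [x _ xmax] := @Order.TotalTheory.arg_maxP _ _ T x0 xpredT f isT.
suff fx y : f y = f x by move=> y; rewrite !fx.
have cl : fingraph.closed e [pred w | f w == f x].
  apply: intro_closed => [|u v euv]; first exact: sym_connect_sym.
  rewrite !inE => /eqP fu; rewrite eq_sym -subr_eq0.
  have s0 : \sum_(w | e u w) (f x - f w) = 0.
    rewrite sumrB -[X in _ - X](mulfVK (_ : (degree e u)%:R != 0)); last first.
      by rewrite pnatr_eq0 -lt0n.
    rewrite -walk_meanE -f_harm fu mulrC degreeE mulr_suml.
    by under [X in _ - X]eq_bigr do rewrite mul1r; rewrite subrr.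
  apply/eqP; apply: (psumr_eq0P _ s0) => // w _; rewrite subr_ge0.
  exact: xmax.
by have := closed_connect cl (e_conn x y); rewrite !inE eqxx => /esym/eqP.
Qed.

End Deviation.

(** An injective endomorphism of a finite-dimensional space is onto; the matrix is
    transposed because matrices act on row vectors. *)
Lemma kernel_inj_surj (R : realType) (T : finType) (K : T -> T -> R) :
  (forall f : T -> R, (forall x, \sum_y K x y * f y = 0) -> forall x, f x = 0) ->
  forall b : T -> R, exists f : T -> R, forall x, \sum_y K x y * f y = b x.
Proof.
move=> K_inj b.
pose A : 'M[R]_#|T| := \matrix_(i, j) K (enum_val j) (enum_val i).
have actE (v : 'rV[R]_#|T|) x :
    \sum_y K x y * v 0 (enum_rank y) = (v *m A) 0 (enum_rank x).
  rewrite (reindex _ (onW_bij _ (@enum_val_bij T))) mxE /=; apply: eq_bigr => i _.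
  by rewrite !mxE enum_valK enum_rankK mulrC.
have A_unit : A \in unitmx.
  rewrite -row_free_unit; apply: inj_row_free => v vA0.
  apply/rowP => i; rewrite mxE -[i]enum_valK.
  by apply: (K_inj (fun y => v 0 (enum_rank y))) => x; rewrite actE vA0 mxE.
exists (fun y => (\row_j b (enum_val j) *m invmx A) 0 (enum_rank y)) => x.
by rewrite actE mulmxKV // mxE enum_rankK.
Qed.

(** Solve [(I - P + 1 pi) f = b] for [b] of [pi]-mean 0: applying [pi] to both sides
    shows that [f] has [pi]-mean 0 as well, so [f - P f = b]. With [b = 0] this gives
    injectivity by the maximum principle; the columns of the kernel are the
    solutions for [b x = (x == z) - pi z], and their sum solves the system with
    right-hand side 0, so it vanishes. *)
Lemma deviation_kernel_exists (R : realType) (T : finType) (e : rel T) :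
  symmetric e -> irreflexive e -> connected_graph e ->
  (forall x, (0 < degree e x)%N) ->
  exists g : T -> T -> R, deviation_kernel e g.
Proof.
move=> e_sym e_irr e_conn deg_gt0; pose p := stationary R e.
pose K x y : R := (x == y)%:R - step_prob R e x y + p y.
have pi_sum (x : T) : \sum_z p z = 1 by apply: sum_stationary.
have KE f x : \sum_y K x y * f y = f x - walk_mean e f x + \sum_y p y * f y.
  rewrite /walk_mean -[f x](sum_delta f) -sumrB -big_split /=.
  by apply: eq_bigr => y _; rewrite /K; ring.
have solve f b : (forall x, \sum_y K x y * f y = b x) -> \sum_x p x * b x = 0 ->
    forall x, f x - walk_mean e f x = b x.
  move=> Kf pb x; rewrite -Kf KE.
  suff -> : \sum_y p y * f y = 0 by rewrite addr0.
  transitivity (\sum_x p x * b x) => //.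
  under [RHS]eq_bigr do rewrite -Kf KE mulrDr mulrBr.
  rewrite big_split sumrB /= stationary_walk_mean // subrr add0r -mulr_suml.
  by rewrite (pi_sum x) mul1r.
have K_inj (f : T -> R) : (forall x, \sum_y K x y * f y = 0) -> forall x, f x = 0.
  move=> Kf0 x.
  have f_harm y : f y = walk_mean e f y.
    apply/eqP; rewrite -subr_eq0; apply/eqP.
    by apply: (solve f (fun=> 0)) => //; apply: big1 => w _; rewrite mulr0.
  have f_cst := harmonic_cst deg_gt0 e_sym e_conn f_harm x.
  have := Kf0 x; rewrite KE -f_harm subrr add0r => <-.
  under eq_bigr do rewrite -f_cst.
  by rewrite -mulr_suml (pi_sum x) mul1r.
have /choice[g gE] : forall z, exists f : T -> R, forall x,
    \sum_y K x y * f y = (x == z)%:R - p z.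
  by move=> z; apply: (kernel_inj_surj K_inj).
exists (fun x z => g z x); split => [x z|].
  apply: (solve (g z) (fun x => (x == z)%:R - p z) (gE z)).
  under eq_bigr do rewrite mulrBr mulrC eq_sym.
  by rewrite sumrB sum_delta -mulr_suml (pi_sum x) mul1r subrr.
apply: K_inj => x; under eq_bigr do rewrite mulr_sumr.
rewrite exchange_big /=; under eq_bigr do rewrite gE.
rewrite sumrB (pi_sum x).
under eq_bigr do rewrite -[_%:R]mulr1.
by rewrite (sum_delta (fun=> 1)) subrr.
Qed.

(** * The subdivision graph *)

Lemma connected_degree_gt0 (T : finType) (e : rel T) :
  connected_graph e -> (2 <= #|T|)%N -> forall x, (0 < degree e x)%N.
Proof.
move=> e_conn n_ge2 x.
have /card_gt0P[y] : (0 < #|predC1 x|)%N by rewrite cardC1 -ltnS prednK // ltnW.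
rewrite !inE => yx; have /connectP[[|z p] /= path_p yE] := e_conn x y.
  by rewrite yE eqxx in yx.
by apply/card_gt0P; exists z; rewrite inE; case/andP: path_p.
Qed.

Section Subdivision.
Variables (R : realType) (T : finType) (e : rel T) (q : nat).
Hypotheses (q_gt0 : (0 < q)%N) (e_sym : symmetric e) (e_irr : irreflexive e).
Hypothesis deg_gt0 : forall x, (0 < degree e x)%N.

Local Notation S := (subdiv_node e q).
Local Notation eS := (@subdiv T e q).
Local Notation m := (#|edge_set e|%:R : R).
Local Notation pi := (stationary R e).
Local Notation piS := (stationary R eS).
Implicit Types (u v x y : T) (s t : S).

Lemma subdiv_sym : symmetric eS.
Proof. by move=> [u|[a k]] [v|[b l]]. Qed.

Lemma subdiv_irr : irreflexive eS.
Proof. by move=> [u|[a k]]. Qed.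

(** The new nodes form a dependent type; [G] expresses [F] through the underlying
    two-element sets, so that the sum can range over [edge_set e]. *)
Lemma sum_subdiv (F : S -> R) (G : {set T} -> 'I_q -> R) :
  (forall a k, F (inr (a, k)) = G (val a) k) ->
  \sum_s F s = \sum_u F (inl u) + \sum_(a in edge_set e) \sum_k G a k.
Proof.
move=> FG; rewrite big_sumType /=; congr (_ + _).
rewrite [RHS]big_sub [RHS]pair_big /=; apply: eq_bigr => -[a k] _; exact: FG.
Qed.

Lemma sum_subdiv_old u (F : S -> R) (G : {set T} -> 'I_q -> R) :
  (forall a k, F (inr (a, k)) = G (val a) k) ->
  \sum_(s | eS (inl u) s) F s = \sum_(y | e u y) \sum_k G [set u; y]%SET k.
Proof.
move=> FG; rewrite -(sum_incident_edges e_sym e_irr (fun a => \sum_k G a k)).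
rewrite big_mkcond (@sum_subdiv _ (fun a k => if u \in a then G a k else 0)).
  rewrite big1 // add0r [RHS]big_mkcondr; apply: eq_bigr => a _.
  by case: ifP => // _; rewrite big1.
by move=> a k /=; rewrite FG.
Qed.

Lemma sum_subdiv_new a k (F : S -> R) :
  \sum_(s | eS (inr (a, k)) s) F s = \sum_(u in val a) F (inl u).
Proof.
by rewrite big_sumType /= [X in _ + X]big_pred0 ?addr0.
Qed.

Lemma degree_subdiv_old u : (degree eS (inl u))%:R = q%:R * (degree e u)%:R :> R.
Proof.
rewrite !degreeE (@sum_subdiv_old u _ (fun _ _ => 1)) //.
by rewrite mulr_sumr; apply: eq_bigr => y _; rewrite sumr_const card_ord mulr1.
Qed.

Lemma degree_subdiv_new a k : (degree eS (inr (a, k)))%:R = 2 :> R.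
Proof.
rewrite degreeE sum_subdiv_new; have /edge_setP[x [y [exy ->]]] := valP a.
by rewrite (sum_endpoints e_irr (fun=> 1) exy).
Qed.

Lemma degree_subdiv_gt0 s : (0 < degree eS s)%N.
Proof.
rewrite -(ltr0n R); case: s => [u|[a k]]; last by rewrite degree_subdiv_new.
by rewrite degree_subdiv_old mulr_gt0 ?ltr0n.
Qed.

(** The handshake identity in the subdivision: the old nodes contribute [2 m q] to
    the sum of the degrees, and so do the [m q] new ones. *)
Lemma edges_subdiv : #|edge_set eS|%:R = 2 * m * q%:R :> R.
Proof.
have two0 : (2 : R) != 0 by rewrite pnatr_eq0.
apply: (mulfI two0); rewrite -(handshake R subdiv_sym subdiv_irr).
rewrite (@sum_subdiv _ (fun _ _ => 2)); last exact: degree_subdiv_new.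
under eq_bigr do rewrite degree_subdiv_old.
rewrite -mulr_sumr handshake // !sumr_const card_ord.
by rewrite -[X in _ + X]mulr_natr -[X in _ + X * _]mulr_natr; ring.
Qed.

Lemma stationary_subdiv_old u : piS (inl u) = pi u / 2.
Proof.
have m0 := edges_neq0 R deg_gt0 u.
rewrite /stationary edges_subdiv degree_subdiv_old; field.
by rewrite m0 pnatr_eq0 -lt0n q_gt0.
Qed.

Lemma stationary_subdiv_new a k : piS (inr (a, k)) = (2 * m * q%:R)^-1.
Proof.
rewrite /stationary edges_subdiv degree_subdiv_new invfM mulrA.
by rewrite mulfV ?mul1r ?pnatr_eq0.
Qed.

(** ** A deviation kernel of the subdivision *)

Variable g : T -> T -> R.
Hypothesis g_dev : deviation_kernel e g.

(** The rows of the kernel at old nodes. Eliminating the new nodes leaves, for the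
    column of [t], the equation of [old_column], in which the right-hand side is a
    combination of the functions [x |-> (x == y) - pi y] with coefficients 1 at
    [y = v] for an old node [t = v], and [1 / (q d_y)] at the two ends [y] of the
    edge for a new node; replacing each of these functions by twice the column
    [g _ y] solves it. *)
Definition subdiv_dev_old u t : R :=
  match t with
  | inl v => 2 * g u v
  | inr (b, _) => 2 / q%:R * \sum_(y in val b) g u y / (degree e y)%:R
  end.

Definition midpoint_avg s t : R :=
  match s with
  | inl _ => 0
  | inr (a, _) => (\sum_(u in val a) subdiv_dev_old u t) / 2
  end.

(** At a new node the equation of a deviation kernel prescribes the value from those
    at the two neighbouring old nodes. *)
Definition subdiv_dev s t : R :=
  match s with
  | inl u => subdiv_dev_old u t
  | inr _ => midpoint_avg s t + (s == t)%:R - piS t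
  end.

Lemma sum_old_row u : \sum_t subdiv_dev_old u t = 0.
Proof.
have [_ g_row] := g_dev.
have q0 : q%:R != 0 :> R by rewrite pnatr_eq0 -lt0n.
rewrite (@sum_subdiv _
  (fun b _ => 2 / q%:R * \sum_(y in b) g u y / (degree e y)%:R)) //=.
rewrite -mulr_sumr g_row mulr0 add0r.
under eq_bigr do rewrite sumr_const card_ord -[_ *+ q]mulr_natr mulrAC divfK //.
rewrite -mulr_sumr sum_edge_endpoints //.
under eq_bigr => y _.
  rewrite sumr_const -[_ *+ _]mulr_natr.
  rewrite (_ : #|_| = degree e y); last by rewrite /degree cardsE.
  rewrite divfK ?pnatr_eq0 -?lt0n //; over.
by rewrite g_row mulr0.
Qed.

(** The system satisfied by a column of the kernel once the new nodes are
    eliminated: the division by 2 is the laziness of the walk observed every second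
    step, and [piS t] is subtracted once for each of the two steps. *)
Lemma old_column u t :
  (subdiv_dev_old u t - walk_mean e (subdiv_dev_old^~ t) u) / 2 =
  (inl u == t)%:R + (eS (inl u) t)%:R / (q%:R * (degree e u)%:R) - 2 * piS t.
Proof.
have [g_eq _] := g_dev.
have q0 : q%:R != 0 :> R by rewrite pnatr_eq0 -lt0n.
have m0 := edges_neq0 R deg_gt0 u.
case: t => [v|[b l]].
  rewrite walk_meanZ -mulrBr g_eq stationary_subdiv_old /= mul0r addr0.
  rewrite (_ : (inl u == inl v :> S) = (u == v)) //.
  by field.
rewrite stationary_subdiv_new (_ : (inl u == inr (b, l) :> S) = false) //=.
rewrite walk_meanZ -mulrBr.
(* Since [pi y / d_y] is the constant [1 / (2 m)], the mean subtracts it once for each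
   end of the edge. *)
have -> : \sum_(y in val b) g u y / (degree e y)%:R -
    walk_mean e (fun x => \sum_(y in val b) g x y / (degree e y)%:R) u =
    \sum_(y in val b) ((u == y)%:R / (degree e y)%:R - (2 * m)^-1).
  rewrite /walk_mean; under [X in _ - X]eq_bigr do rewrite mulr_sumr.
  rewrite exchange_big -sumrB /=; apply: eq_bigr => y _.
  under eq_bigr do rewrite mulrA.
  rewrite -mulr_suml -mulrBl -/(walk_mean e (g^~ y) u) g_eq mulrBl.
  congr (_ - _); rewrite /stationary mulrAC mulfV ?mul1r //.
  by rewrite pnatr_eq0 -lt0n.
rewrite sumrB.
have -> : \sum_(y in val b) (u == y)%:R / (degree e y)%:R =
          (u \in val b)%:R / (degree e u)%:R :> R.
  rewrite big_mkcond -(sum_delta (fun y => (y \in val b)%:R / (degree e y)%:R)).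
  by apply: eq_bigr => y _; case: (y \in val b); rewrite ?mul0r ?mulr0 // mul1r.
have -> : \sum_(y in val b) (2 * m)^-1 = m^-1.
  have /edge_setP[x [y [exy ->]]] := valP b.
  by rewrite (sum_endpoints e_irr (fun=> _) exy); field.
have d0 : (degree e u)%:R != 0 :> R by rewrite pnatr_eq0 -lt0n.
by field; rewrite q0 m0 d0.
Qed.

(** At a new node the equation holds by construction. At an old node [u], averaging
    the new rows over the neighbours of [u] gives the lazy mean of
    [subdiv_dev_old], together with the corrections at [t], and [old_column]
    concludes. *)
Lemma subdiv_deviation : deviation_kernel eS subdiv_dev.
Proof.
have q0 : q%:R != 0 :> R by rewrite pnatr_eq0 -lt0n.
split=> [[u|[a k]] t|[u|[a k]]].
- have d0 : (degree e u)%:R != 0 :> R by rewrite pnatr_eq0 -lt0n.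
  have -> : walk_mean eS (subdiv_dev^~ t) (inl u) =
      (subdiv_dev_old u t + walk_mean e (subdiv_dev_old^~ t) u) / 2
      + (eS (inl u) t)%:R / (q%:R * (degree e u)%:R) - piS t.
    rewrite walk_meanE degree_subdiv_old.
    have -> : \sum_(s | eS (inl u) s) subdiv_dev s t =
        \sum_(s | eS (inl u) s) midpoint_avg s t
        + \sum_(s | eS (inl u) s) (t == s)%:R - \sum_(s | eS (inl u) s) piS t.
      rewrite -big_split -sumrB; apply: eq_bigr => -[v|[a k]]; first by [].
      by move=> _; rewrite [t == _]eq_sym.
    have -> : \sum_(s | eS (inl u) s) piS t = q%:R * (degree e u)%:R * piS t.
      rewrite -degree_subdiv_old degreeE mulr_suml.
      by apply: eq_bigr => s _; rewrite mul1r.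
    have -> : \sum_(s | eS (inl u) s) (t == s)%:R = (eS (inl u) t)%:R :> R.
      rewrite big_mkcond -[RHS](sum_delta (fun s => (eS (inl u) s)%:R)).
      by apply: eq_bigr => s _; case: (eS _ _); rewrite ?mulr1 ?mulr0.
    rewrite (@sum_subdiv_old u _
      (fun a _ => (\sum_(v in a) subdiv_dev_old v t) / 2)) //.
    have -> : \sum_(y | e u y) \sum_(k < q)
          (\sum_(v in [set u; y]%SET) subdiv_dev_old v t) / 2
       = q%:R / 2 * ((degree e u)%:R * subdiv_dev_old u t
                     + \sum_(y | e u y) subdiv_dev_old y t).
      rewrite degreeE mulr_suml -big_split mulr_sumr; apply: eq_bigr => y euy.
      rewrite sumr_const card_ord (sum_endpoints e_irr _ euy).
      by rewrite -[_ *+ q]mulr_natr /=; field.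
    by rewrite walk_meanE; field; rewrite q0 d0.
  by have := old_column u t; rewrite /=; lra.
- by rewrite walk_meanE sum_subdiv_new degree_subdiv_new /=; ring.
- exact: sum_old_row.
- rewrite /subdiv_dev sumrB big_split /=.
  rewrite (sum_stationary R degree_subdiv_gt0 subdiv_sym subdiv_irr (inr (a, k))).
  under [X in _ + X - _]eq_bigr do rewrite -[_%:R]mulr1.
  rewrite (sum_delta (fun=> 1)) addrK -mulr_suml exchange_big /=.
  by rewrite big1 ?mul0r // => u _; apply: sum_old_row.
Qed.

(** The old nodes contribute [2 tr g]. The new nodes contribute [m q - 1/2] through
    the corrections, and the sum of [g u y / d_y] over edges and pairs [u], [y] of
    ends: [tr g] from [u = y], and [\sum_y (P g(_, y)) y = tr g - n + 1] from
    [u != y]. *)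
Lemma subdiv_dev_trace (x0 : T) :
  \sum_s subdiv_dev s s =
  4 * \sum_x g x x + (2 * m * q%:R - 2 * #|T|%:R + 1) / 2.
Proof.
have [g_eq _] := g_dev.
have q0 : q%:R != 0 :> R by rewrite pnatr_eq0 -lt0n.
have m0 := edges_neq0 R deg_gt0 x0.
rewrite (@sum_subdiv _ (fun a _ =>
  (\sum_(y in a) \sum_(u in a) g u y / (degree e y)%:R) / q%:R
   + 1 - (2 * m * q%:R)^-1)) => [|a k]; last first.
  rewrite /subdiv_dev eqxx stationary_subdiv_new /= -mulr_sumr exchange_big /=.
  by congr (_ + _ - _); field.
under [X in _ + X]eq_bigr do
  rewrite sumr_const card_ord -[_ *+ q]mulr_natr mulrBl mulrDl divfK //.
rewrite sumrB big_split /= sum_edge_endpoints //.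
have -> : \sum_y \sum_(z | e y z) \sum_(u in [set y; z]%SET) g u y / (degree e y)%:R
    = 2 * \sum_y g y y - #|T|%:R + 1.
  transitivity (\sum_y (2 * g y y - 1 + pi y)); last first.
    rewrite big_split sumrB -mulr_sumr (sum_stationary R deg_gt0 e_sym e_irr x0).
    by rewrite sumr_const.
  apply: eq_bigr => y _.
  have -> : \sum_(z | e y z) \sum_(u in [set y; z]%SET) g u y / (degree e y)%:R
      = g y y + walk_mean e (g^~ y) y.
    have d0 : (degree e y)%:R != 0 :> R by rewrite pnatr_eq0 -lt0n.
    transitivity (\sum_(z | e y z) (g y y + g z y) / (degree e y)%:R).
      by apply: eq_bigr => z eyz; rewrite (sum_endpoints e_irr _ eyz) mulrDl.
    rewrite -mulr_suml big_split /= mulrDl; congr (_ + _); last by rewrite walk_meanE.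
    by have := walk_mean_cst (g y y) (deg_gt0 y); rewrite walk_meanE.
  by have := g_eq y y; rewrite eqxx /=; lra.
rewrite !sumr_const -mulr_sumr /= -[_ *+ #|_|]mulr_natr -[X in _ - X]mulr_natr.
by field; rewrite q0 m0.
Qed.

End Subdivision.

Theorem theorem5p2 (R : realType) (q : nat) (T : finType) (e : rel T)
    (q_ge1 : (1 <= q)%N) (e_sym : symmetric e) (e_irr : irreflexive e)
    (e_conn : connected_graph e) (n_ge2 : (2 <= #|T|)%N)
    (i : T) (s : subdiv_node e q) :
  let n : R := #|T|%:R in
  let m : R := #|edge_set e|%:R in
  kemeny R e i \is a fin_num /\
  kemeny R (@subdiv T e q) s
    = (4%:E * kemeny R e i + ((2 * m * q%:R - 2 * n + 1) / 2)%:E)%E.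
Proof.
move=> n m; have deg_gt0 := connected_degree_gt0 e_conn n_ge2.
have [g g_dev] := deviation_kernel_exists R e_sym e_irr e_conn deg_gt0.
have gS_dev := subdiv_deviation q_ge1 e_sym e_irr deg_gt0 g_dev.
rewrite (kemeny_trace deg_gt0 i g_dev); split=> //.
rewrite (kemeny_trace (degree_subdiv_gt0 R q_ge1 e_sym e_irr deg_gt0) s gS_dev).
by rewrite (subdiv_dev_trace q_ge1 e_sym e_irr deg_gt0 g_dev i) EFinD EFinM.
Qed.
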